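(* Consider directed or undirected decoupled freeform spanner problems with $n$ nodes, integer lengths, and distance demands that are polynomially bounded in $n$; let $\bar\delta=\max_{(u,v)\in K}\delta(u,v)$ be the maximum distance demand. Let $\bar\mu=(\bar\delta+2)^{n-2}$ and $\gamma=\ln(n\,\bar\mu\,|K|)$. Then the randomized algorithm RandomizedRounding returns a subgraph $H$ of $G$ that is a feasible spanner with high probability (namely, with probability at least $1-\tfrac1n$), with expected approximation ratio (expected weight of $H$ relative to $\mathrm{OPT}$, the minimum weight of a feasible spanner) $$\gamma=\ln(n\,\bar\mu\,|K|)\le\ln\!\big(n^3(\bar\delta+2)^{n-2}\big)\in\mathcal{O}(n\log\bar\delta)\subseteq\mathcal{O}(n\log n).$$
   Context: Decoupled freeform spanner problem. An instance consists of a connected, simple, directed or undirected graph $G=(V,E)$ with $n$ nodes and $m$ edges, terminal pairs $K\subseteq V\times V$ (unordered pairs in the undirected case), weights $w\colon E\to\mathbb{Q}_{\ge 0}$, lengths $\ell\colon E\to\mathbb{Q}_{>0}$, and distance demands $\delta\colon K\to\mathbb{Q}_{>0}$. $d^\ell_{G'}(u,v)$ is the shortest-path distance from $u$ to $v$ in $G'$ w.r.t. $\ell$. A feasible spanner is a subgraph $H=(V,E')$, $E'\subseteq E$, with $d_H^\ell(u,v)\le\delta(u,v)$ for all $(u,v)\in K$; the task is to find a feasible spanner (one is understood to exist) minimizing $w(H)=\sum_{e\in E'}w(e)$. Here lengths are integers, hence w.l.o.g. demands are integers. $\bar\delta$-extension. For directed $G$, the $\bar\delta$-extension $G^{\bar\delta}=(V^{\bar\delta},E^{\bar\delta})$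 has layers $V_0^{\bar\delta},\dots,V_{\bar\delta}^{\bar\delta}$, each a copy of $V$; $q_i$ is the copy of $q\in V$ in layer $i$. For each $e=(s,t)\in E$ there are arcs $(s_i,t_{i+\ell(e)})$ for $0\le i\le\bar\delta-\ell(e)$; for each $q\in V$ there are self-arcs $(q_i,q_{i+1})$ for $0\le i<\bar\delta$. LP (MCF): minimize $\sum_{e\in E}w(e)x_e$ subject to (a) $\sum_{i=0}^{\bar\delta-\ell(e)}f^{uv}_{(s_i,t_{i+\ell(e)})}\le x_e$ for all $(u,v)\in K$, $e=(s,t)\in E$; (b) for all $(u,v)\in K$, $q\in V^{\bar\delta}$: (sum of $f^{uv}$ over arcs leaving $q$) $-$ (sum of $f^{uv}$ over arcs entering $q$) equals $\mathbb 1_{q=u_0}-\mathbb 1_{q=v_{\delta(u,v)}}$; (c) $0\le f^{uv}_a\le1$ for all $(u,v)\in K$, $a\in E^{\bar\delta}$, and $0\le x_e\le1$ for all $e\in E$. For undirected $G$, use the $\bar\delta$-extension of the bidirected version of $G$, one variable $x_e$ per undirected edge, and constraint (a) once for each of the two directions of $e$. RandomizedRounding: compute an optimal solution of (MCF) with values $x_e^*$ for $e\in E$; set $\gamma=\ln(n\bar\mu|K|)$ with $\bar\mu=(\bar\delta+2)^{n-2}$; include each $e\in E$ in $E'$ independently with probability $\min\{1,\gamma x_e^*\}$; return $H=(V,E')$.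
   Formalization: The bound O(n log δ̄) and its inclusion in O(n log n) are stated for δ̄ ≥ 2, since for δ̄ = 1 log δ̄ = 0 while ln(n³·3^{n−2}) grows linearly in n; the O(n log n) bound itself is also stated for δ̄ = 1. *)

(* Defs.v *)
(* MathComp / MathComp-Analysis *)
From mathcomp Require Import all_boot all_order all_algebra.
From mathcomp Require Import all_classical all_reals all_analysis.
Set Implicit Arguments.
Unset Strict Implicit.
Unset Printing Implicit Defensive.
Import Order.TTheory GRing.Theory Num.Theory.
Import numFieldNormedType.Exports.
Local Open Scope ring_scope.

(* In the undirected case, an unordered pair (an edge or a terminal pair) is
   stored as exactly one of its two orientations, chosen arbitrarily, so that
   cardinals and sums over [edges] and [terminals] count it once.
   A directed graph may have antiparallel arcs; it is connected when its
   underlying undirected graph is. *)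
Record instance (V : finType) := Instance {
  directed : bool;
  edges : {set V * V};
  terminals : {set V * V};
  weight : V * V -> rat;
  len : V * V -> nat;
  demand : V * V -> nat;
  edges_loopless : forall v, (v, v) \notin edges;
  edges_once : ~~ directed ->
    forall s t, (s, t) \in edges -> (t, s) \notin edges;
  terminals_once : ~~ directed ->
    forall u v, (u, v) \in terminals -> (v, u) \in terminals -> u = v;
  graph_connected : forall u v,
    connect (fun s t => ((s, t) \in edges) || ((t, s) \in edges)) u v;
  weight_ge0 : forall e, e \in edges -> 0 <= weight e;
  len_gt0 : forall e, e \in edges -> (0 < len e)%N;
  demand_gt0 : forall uv, uv \in terminals -> (0 < demand uv)%N
}.

Section Spanner.
Context {V : finType} (I : instance V).

Definition arcs_of (H : {set V * V}) : {set V * V} :=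
  if directed I then H else H :|: [set (e.2, e.1) | e in H].

Definition edge_of (a : V * V) : V * V :=
  if a \in edges I then a else (a.2, a.1).

Definition arc_len (a : V * V) : nat := len I (edge_of a).

Definition path_in (H : {set V * V}) (u v : V) (p : seq V) : bool :=
  path (fun s t => (s, t) \in arcs_of H) u p && (last u p == v).

Definition path_len (u : V) (p : seq V) : nat :=
  sumn (pairmap (fun s t => arc_len (s, t)) u p).

Definition max_demand : nat := \max_(uv in terminals I) demand I uv.

(* Node (q, i) of the extension is the copy of q in layer i. *)
Definition ext_node := (V * 'I_max_demand.+1)%type.

Definition ext_arcs : {set ext_node * ext_node} :=
  [set a : ext_node * ext_node | ((a.1.1, a.2.1) \in arcs_of (edges I))
           && (a.2.2 == a.1.2 + arc_len (a.1.1, a.2.1) :> nat)%N]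
  :|: [set a : ext_node * ext_node | (a.1.1 == a.2.1) && (a.2.2 == a.1.2.+1 :> nat)].

End Spanner.

Section Approximation.
Context (R : realType) {V : finType} (I : instance V).

(* +oo when v is not reachable from u in (V, H) *)
Definition dist (H : {set V * V}) (u v : V) : \bar R :=
  ereal_inf [set ((path_len I u p)%:R)%:E | p in [set p | path_in I H u v p]].

Definition feasible (H : {set V * V}) : Prop :=
  H \subset edges I /\
  forall u v, (u, v) \in terminals I ->
    (dist H u v <= ((demand I (u, v))%:R)%:E)%E.

Definition spanner_weight (H : {set V * V}) : R :=
  \sum_(e in H) ratr (weight I e).

(* There are finitely many spanners: the infimum is a minimum as soon as there
   is a feasible one. *)
Definition opt : R := inf [set spanner_weight H | H in [set H | feasible H]].

(* Only the values of x on [edges I] and of f on [terminals I] and [ext_arcs I]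
   matter. *)
Definition lp_feasible (x : V * V -> R)
    (f : V * V -> ext_node I * ext_node I -> R) : Prop :=
  [/\ forall uv s t, uv \in terminals I -> (s, t) \in arcs_of I (edges I) ->
        \sum_(i < (max_demand I).+1 | (i + arc_len I (s, t) <= max_demand I)%N)
           f uv ((s, i), (t, inord (i + arc_len I (s, t))))
        <= x (edge_of I (s, t)),
      forall u v (q : ext_node I), (u, v) \in terminals I ->
        \sum_(a in ext_arcs I | a.1 == q) f (u, v) a
        - \sum_(a in ext_arcs I | a.2 == q) f (u, v) a
        = (q == (u, ord0))%:R - (q == (v, inord (demand I (u, v))))%:R,
      forall uv a, uv \in terminals I -> a \in ext_arcs I -> 0 <= f uv a <= 1
    & forall e, e \in edges I -> 0 <= x e <= 1].

Definition lp_value (x : V * V -> R) : R :=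
  \sum_(e in edges I) ratr (weight I e) * x e.

Definition lp_optimal x f : Prop :=
  lp_feasible x f /\ forall x' f', lp_feasible x' f' -> lp_value x <= lp_value x'.

(* An integer power, since n - 2 = -1 for the one-node graph. *)
Definition mu : R := (max_demand I + 2)%:R ^ (#|V|%:Z - 2).

Definition gamma : R := ln (#|V|%:R * mu * #|terminals I|%:R).

Definition inclusion_prob (x : V * V -> R) (e : V * V) : R :=
  Num.min 1 (gamma * x e).

(* Probability that the independent choices for the edges produce exactly H. *)
Definition rounding_law (x : V * V -> R) (H : {set V * V}) : R :=
  (\prod_(e in H) inclusion_prob x e)
  * \prod_(e in edges I :\: H) (1 - inclusion_prob x e).

Definition rounding_prob (x : V * V -> R) (A : {set V * V} -> Prop) : R :=
  \sum_(H in powerset (edges I) | `[< A H >]) rounding_law x H.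

Definition rounding_expect (x : V * V -> R) (X : {set V * V} -> R) : R :=
  \sum_(H in powerset (edges I)) rounding_law x H * X H.

Lemma rounding_probT x : rounding_prob x (fun=> True) = 1.
Proof.
rewrite /rounding_prob /rounding_law; set p := inclusion_prob x.
pose q e := if e \in edges I then p e else 0.
transitivity (\prod_(e : V * V) (q e + (1 - q e))); last first.
  by apply: big1 => e _; rewrite addrC subrK.
rewrite bigA_distr; rewrite [RHS](bigID (mem (powerset (edges I)))) /=.
rewrite [X in _ = _ + X]big1 ?addr0; last first.
  move=> H; rewrite powersetE => /fintype.subsetPn[e eH eE].
  rewrite (bigD1 e) //= eH /q (negbTE eE) mul0r //.
apply: eq_big => [H|H]; first by rewrite asboolT ?andbT.
rewrite powersetE asboolT // andbT => /fintype.subsetP HE.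
rewrite [RHS](bigID (mem H)) /=; congr (_ * _).
  by apply: eq_bigr => e eH; rewrite eH /q HE.
rewrite [RHS](bigID (mem (edges I))) /= [X in _ = _ * X]big1 ?mulr1.
  apply: eq_big => [e|e]; first by rewrite inE.
  by rewrite inE => /andP[/negbTE -> eE]; rewrite /q eE.
by move=> e /andP[/negbTE -> /negbTE eE]; rewrite /q eE subr0.
Qed.

End Approximation.

Section Asymptotics.
Local Open Scope classical_set_scope.
Context (R : realType).

Definition gamma_bound (n d : nat) : R :=
  ln (n%:R ^+ 3 * (d + 2)%:R ^ (n%:Z - 2)).

(* (n, d) ranges over D, and n tends to infinity uniformly in d. *)
Definition large_n (D : set (nat * nat)) : filter_on (nat * nat) :=
  FilterType (within D (filter_prod \oo (globally setT))) (within_filter _ _).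

End Asymptotics.

(* Main.v *)
Require Import Defs.
From mathcomp Require Import all_boot all_order all_algebra.
From mathcomp Require Import all_classical all_reals all_analysis.
Set Implicit Arguments.
Unset Strict Implicit.
Unset Printing Implicit Defensive.
Import Order.TTheory GRing.Theory Num.Theory.
Import numFieldNormedType.Exports.
Local Open Scope ring_scope.

(* Feasibility.  Suppose (V, H) has no u-v path of length at most delta(u,v).
   Label every node q by its distance from u in (V, H), capped at delta(u,v) + 1.
   No arc of H increases the label by more than its length, so H avoids the set
   B of edges having an orientation that does.  In the extension, the copies q_i
   with i >= label q form a cut separating u_0 from v_delta that is left only by
   arcs above B; the unit flow thus gives sum_(e in B) x_e >= 1, and independent
   rounding avoids B with probability at most exp (- gamma).  The labels at u and
   v are prescribed, so a union bound over the (delta_max + 2)^(n - 2) labellings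
   and the |K| terminal pairs yields 1 / n.

   Cost.  The expected weight is at most gamma times the LP value, and the LP
   value is at most OPT, as a loop-free path of length at most delta(u,v) lifts
   to an integral unit flow in the extension.  For n = 1 gamma is negative, but
   there are no edges. *)

(** * Independent rounding *)
Section Rounding.
Context {R : realType} {V : finType} (I : instance V).
Implicit Types (x : V * V -> R) (H B : {set V * V}).

(** Independence: expanding the right-hand product of sums gives one term per subset [H]. The event
    probabilities below are instances with 0/1 factors. *)
Lemma rounding_expect_prod x (a b : V * V -> R) :
  rounding_expect I x
    (fun H => \prod_(e in edges I) if e \in H then a e else b e) =
  \prod_(e in edges I)
    (inclusion_prob I x e * a e + (1 - inclusion_prob I x e) * b e).
Proof.
rewrite /rounding_expect /rounding_law; set p := inclusion_prob I x.
(* The values 0 and 1 off [edges I] make only subsets of [edges I] survive when the product over all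
   pairs is expanded. *)
pose F e := if e \in edges I then p e * a e else 0.
pose G e := if e \in edges I then (1 - p e) * b e else 1.
transitivity (\prod_e (F e + G e)); last first.
  rewrite [RHS]big_mkcond; apply: eq_bigr => e _; rewrite /F /G.
  by case: ifP => // _; rewrite add0r.
rewrite bigA_distr [RHS](bigID (mem (powerset (edges I)))) /=.
rewrite [X in _ = _ + X]big1 ?addr0; last first.
  move=> H; rewrite powersetE => /fintype.subsetPn[e eH eE].
  by rewrite (bigD1 e) //= eH /F (negbTE eE) mul0r.
apply: eq_big => // H; rewrite powersetE => /fintype.subsetP HE.
rewrite [RHS](bigID (mem (edges I))) /= [X in _ = _ * X]big1 ?mulr1; last first.
  by move=> e eE; rewrite /F /G (negbTE eE); case: ifP => // /HE; rewrite (negbTE eE).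
rewrite [\prod_(e in H) _]big_mkcond [\prod_(e in _ :\: _) _]big_mkcond.
rewrite [\prod_(e in edges I) _]big_mkcond [RHS]big_mkcond -!big_split /=.
apply: eq_bigr => e _; rewrite inE /F /G.
case: (boolP (e \in edges I)) => eE; case: (boolP (e \in H)) => eH /=.
- by rewrite mulr1.
- by rewrite mul1r.
- by rewrite (HE _ eH) in eE.
- by rewrite !mulr1.
Qed.

Lemma rounding_prob_disjoint x B : B \subset edges I ->
  rounding_prob I x (fun H => [disjoint H & B]) =
  \prod_(e in B) (1 - inclusion_prob I x e).
Proof.
move=> /fintype.subsetP BE.
(* The indicator of disjointness is a product over edges: a chosen edge of [B] contributes 0. *)
transitivity (rounding_expect I x
   (fun H => \prod_(e in edges I) if e \in H then (e \notin B)%:R else 1)).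
  rewrite /rounding_prob /rounding_expect [RHS](bigID (fun H => `[< [disjoint H & B] >])) /=.
  rewrite [X in _ = _ + X]big1 ?addr0; last first.
    move=> H /andP[_ /asboolPn/negP]; rewrite disjoint_subset.
    move=> /fintype.subsetPn[e eH]; rewrite !inE negbK => eB.
    by rewrite (bigD1 e) ?BE //= eH eB mul0r mulr0.
  apply: eq_bigr => H /andP[_ /asboolP HB]; rewrite big1 ?mulr1 // => e _.
  by case: ifP => // eH; rewrite (disjointFr HB eH).
rewrite rounding_expect_prod [RHS]big_mkcond [LHS]big_mkcond /=.
apply: eq_bigr => e _; case: (boolP (e \in B)) => eB.
  by rewrite BE //= mulr0 add0r mulr1.
by case: ifP => //= _; rewrite !mulr1 addrC subrK.
Qed.

Lemma rounding_prob_mem x e : e \in edges I ->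
  rounding_prob I x (fun H => e \in H) = inclusion_prob I x e.
Proof.
move=> eE.
transitivity (rounding_expect I x (fun H =>
    \prod_(e' in edges I) if e' \in H then 1 else (e' != e)%:R)).
  rewrite /rounding_prob /rounding_expect [RHS](bigID (fun H => `[< e \in H >])) /=.
  rewrite [X in _ = _ + X]big1 ?addr0; last first.
    move=> H /andP[_ /asboolPn/negP/negbTE eH].
    by rewrite (bigD1 e) //= eH eqxx mul0r mulr0.
  apply: eq_bigr => H /andP[_ /asboolP eH]; rewrite big1 ?mulr1 // => e' _.
  by case: ifP => // /negbT e'H; case: eqVneq => // ee'; rewrite ee' eH in e'H.
rewrite rounding_expect_prod (bigD1 e) //= eqxx mulr0 addr0 mulr1.
rewrite big1 ?mulr1 // => e' /andP[_ ->].
by rewrite !mulr1 addrC subrK.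
Qed.

Lemma rounding_expect_weight x :
  rounding_expect I x (spanner_weight R I) =
  \sum_(e in edges I) ratr (weight I e) * inclusion_prob I x e.
Proof.
rewrite /rounding_expect /spanner_weight.
under eq_bigr => H HE.
  have -> : \sum_(e in H) ratr (weight I e) =
      \sum_(e in edges I) if e \in H then ratr (weight I e) else 0 :> R.
    rewrite -big_mkcondr; apply: eq_bigl => e.
    case: (boolP (e \in H)); rewrite ?andbF ?andbT // => eH.
    by move: HE; rewrite powersetE => /fintype.subsetP ->.
  rewrite big_distrr /=.
  over.
rewrite exchange_big; apply: eq_bigr => e eE /=.
rewrite -rounding_prob_mem // /rounding_prob big_distrr /=.
rewrite [RHS]big_mkcondr; apply: eq_bigr => H _; rewrite asboolb.
by case: ifP; rewrite ?mulr0 // mulrC.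
Qed.

Lemma rounding_law_ge0 x H : {in edges I, forall e, 0 <= x e} -> 0 <= gamma R I ->
  H \subset edges I -> 0 <= rounding_law I x H.
Proof.
move=> x0 g0 /fintype.subsetP HE; apply: mulr_ge0; apply: prodr_ge0 => e.
  by move=> /HE eE; rewrite /inclusion_prob le_min ler01 mulr_ge0 // x0.
by move=> _; rewrite subr_ge0 /inclusion_prob ge_min lexx.
Qed.

(** This is [1 - y <= exp (- y)]; where the minimum is 1, the left side is 0. *)
Lemma inclusion_prob_le x e : 1 - inclusion_prob I x e <= expR (- (gamma R I * x e)).
Proof.
rewrite /inclusion_prob /Num.min; case: ifP => _; first by rewrite subrr expR_ge0.
exact: expR_ge1Dx.
Qed.

Lemma rounding_prob_disjoint_le x B : 0 <= gamma R I -> B \subset edges I ->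
  1 <= \sum_(e in B) x e ->
  rounding_prob I x (fun H => [disjoint H & B]) <= expR (- gamma R I).
Proof.
move=> g0 BE xB; rewrite rounding_prob_disjoint //.
apply: (@le_trans _ _ (\prod_(e in B) expR (- (gamma R I * x e)))).
  apply: ler_prod => e _; rewrite inclusion_prob_le andbT.
  by rewrite subr_ge0 /inclusion_prob ge_min lexx.
rewrite -expR_sum ler_expR sumrN lerN2 -mulr_sumr.
by rewrite ler_peMr.
Qed.

(** Union bound over the bad events [C i]. Nonnegative [gamma] makes the law nonnegative, so
    overlapping bad events only overcount. *)
Lemma rounding_prob_ge_union x (T : finType) (P : pred T)
    (C : T -> {set V * V} -> Prop) (A : {set V * V} -> Prop) (c : R) :
  {in edges I, forall e, 0 <= x e} -> 0 <= gamma R I ->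
  (forall H, H \subset edges I -> ~ A H -> exists2 i, P i & C i H) ->
  (forall i, P i -> rounding_prob I x (C i) <= c) ->
  1 - #|P|%:R * c <= rounding_prob I x A.
Proof.
move=> x0 g0 AC Cc; rewrite lerBlDr -[leLHS](rounding_probT I x).
have -> : rounding_prob I x (fun=> True) =
    rounding_prob I x A + rounding_prob I x (fun H => ~ A H).
  rewrite /rounding_prob (bigID (fun H => `[< A H >])) /=.
  by congr (_ + _); apply: eq_bigl => H; rewrite asboolT ?andbT ?asbool_neg.
rewrite lerD2l; apply: (@le_trans _ _ (\sum_(i | P i) rounding_prob I x (C i))).
  rewrite /rounding_prob (exchange_big_dep (mem (powerset (edges I)))) /=; last first.
    by move=> i H _ /andP[].
  rewrite big_mkcondr; apply: ler_sum => H; rewrite powersetE => HE.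
  have l0 := rounding_law_ge0 x0 g0 HE.
  case: asboolP => [/(AC _ HE)[i Pi CiH]|_]; last by apply: sumr_ge0.
  rewrite (bigD1 i) /=; last by rewrite Pi HE asboolT.
  by rewrite lerDl sumr_ge0.
rewrite mulr_natl -sumr_const.
exact: ler_sum.
Qed.

End Rounding.

(** * Cuts of the extension *)
Section Cuts.
Context {V : finType} (I : instance V).
Implicit Types (pi : V -> nat) (H : {set V * V}).

Lemma arcs_of_edge_of a : a \in arcs_of I (edges I) -> edge_of I a \in edges I.
Proof.
rewrite /arcs_of /edge_of; case: (directed I) => [aE|]; first by rewrite aE.
by case: (boolP (a \in edges I)) => // /negbTE aE; rewrite inE aE => /imsetP[[s t] stE ->].
Qed.

(** In the undirected case this rests on [edges_once]: a single orientation of each edge is stored,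
    and [edge_of] recovers it. *)
Lemma mem_arcs_of H a : H \subset edges I ->
  (a \in arcs_of I H) = (a \in arcs_of I (edges I)) && (edge_of I a \in H).
Proof.
move=> /fintype.subsetP HE; have := @edges_once _ I; rewrite /arcs_of /edge_of.
case: (directed I) => [_|/(_ isT) once].
  by case: ifP => // aE; apply/negbTE/negP => /HE; rewrite aE.
case: a => s t; rewrite !inE /=.
have swp (X : {set V * V}) : ((s, t) \in [set (e.2, e.1) | e in X]%SET) = ((t, s) \in X).
  by apply/imsetP/idP => [[[s' t'] + [-> ->]] //|tsX]; exists (t, s).
rewrite !swp; case: ifP => [stE|/negbT stE] /=.
  by rewrite [(t, s) \in H](contraNF (HE _)) ?orbF // once.
rewrite (contraNF (HE _) stE) /=.
by case: (boolP ((t, s) \in H)) => [/HE ->|]; rewrite ?andbF.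
Qed.

(** In the extension, any arc leaving the set of copies [q_i] with [pi q <= i] lies above one of
    these arcs. *)
Definition cut_arcs pi : {set V * V} :=
  [set a in arcs_of I (edges I) | (pi a.1 + arc_len I a < pi a.2)%N]%SET.

Definition cut_edges pi : {set V * V} := [set edge_of I a | a in cut_arcs pi]%SET.

Lemma cut_edges_sub pi : cut_edges pi \subset edges I.
Proof.
apply/fintype.subsetP => _ /imsetP[a + ->]; rewrite inE => /andP[aE _].
exact: arcs_of_edge_of.
Qed.

(** [pi] strictly increases along a cut arc, so no edge is cut in both directions and its [x e] is
    charged only once. *)
Lemma edge_of_inj pi : {in cut_arcs pi &, injective (edge_of I)}.
Proof.
move=> [s t] [s' t']; rewrite !inE /arc_len /edge_of /= => /andP[_ a1] /andP[_ a2].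
move: a1 a2; case: ifP => _; case: ifP => _ a1 a2 [] // E1 E2; subst.
- by [].
- by have := leq_ltn_trans (leq_addr _ _) a1; rewrite ltnNge (ltnW (leq_ltn_trans (leq_addr _ _) a2)).
- by have := leq_ltn_trans (leq_addr _ _) a1; rewrite ltnNge (ltnW (leq_ltn_trans (leq_addr _ _) a2)).
- by [].
Qed.

Lemma demand_le_max uv : uv \in terminals I -> (demand I uv <= max_demand I)%N.
Proof. by move=> uvK; apply: leq_bigmax_cond. Qed.

Lemma lift_arc_ext s t (i : 'I_(max_demand I).+1) : (s, t) \in arcs_of I (edges I) ->
  (i + arc_len I (s, t) <= max_demand I)%N ->
  ((s, i), (t, inord (i + arc_len I (s, t)))) \in ext_arcs I.
Proof. by move=> stE im; rewrite !inE /= stE inordK // eqxx. Qed.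

Lemma cut_edges_ge1 {R : realType} x f pi u v : @lp_feasible R V I x f ->
  (u, v) \in terminals I -> pi u = 0%N -> (demand I (u, v) < pi v)%N ->
  1 <= \sum_(e in cut_edges pi) x e.
Proof.
move=> [capa flow fpos _] uvK pu pv.
pose S := [set q : ext_node I | (pi q.1 <= q.2)%N]%SET.
pose X := ext_arcs I.
(* Sum flow conservation over [S], which contains [u_0] but not the sink. *)
have cons : \sum_(a in X | a.1 \in S) f (u, v) a - \sum_(a in X | a.2 \in S) f (u, v) a = 1.
  rewrite (partition_big (fun a => a.1) (mem S)) /=; last by move=> a /andP[].
  rewrite [X in _ - X](partition_big (fun a => a.2) (mem S)) /=; last by move=> a /andP[].
  rewrite -sumrB.
  transitivity (\sum_(q in S) ((q == (u, ord0))%:R -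
     (q == (v, inord (demand I (u, v))))%:R : R)).
    apply: eq_bigr => q qS; rewrite -flow //; congr (_ - _); apply: eq_bigl => a.
      by case: eqP => [->|]; rewrite ?qS ?andbT ?andbF.
    by case: eqP => [->|]; rewrite ?qS ?andbT ?andbF.
  rewrite sumrB (bigD1 (u, ord0)) /=; last by rewrite inE /= pu.
  rewrite eqxx big1 ?addr0; last by move=> q /andP[_ /negbTE ->].
  rewrite big1 ?subr0 // => q; rewrite inE; case: eqP => // -> /=.
  by rewrite inordK ?ltnS ?demand_le_max // leqNgt pv.
(* Arcs inside [S] cancel, and the flow entering [S] from outside is nonnegative. *)
have cut : 1 <= \sum_(a in X | (a.1 \in S) && (a.2 \notin S)) f (u, v) a.
  rewrite -cons lerBlDr (bigID (fun a => a.2 \in S)) /= addrC lerD //.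
    by rewrite le_eqVlt; apply/orP; left; apply/eqP/eq_bigl => a; rewrite andbA.
  rewrite [leRHS](bigID (fun a => a.1 \in S)) /=.
  rewrite (eq_bigl (fun a => (a \in X) && (a.2 \in S) && (a.1 \in S))); last first.
    by move=> a; rewrite andbAC.
  by rewrite lerDl sumr_ge0 // => a /andP[/andP[aX _] _]; case/andP: (fpos _ _ uvK aX).
apply: (le_trans cut); rewrite big_imset /=; last exact: edge_of_inj.
(* Self-arcs only raise the layer, so they never leave [S]. *)
have memA (a : ext_node I * ext_node I) : (a \in X) && ((a.1 \in S) && (a.2 \notin S)) ->
    (a.1.1, a.2.1) \in cut_arcs pi /\
    (a.2.2 = a.1.2 + arc_len I (a.1.1, a.2.1) :> nat)%N.
  move=> /andP[]; rewrite !inE -ltnNge => /orP[|] /andP[].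
    move=> aA /eqP e12 /andP[le1 lt2]; rewrite aA e12 /=; split => //.
    by rewrite (leq_ltn_trans _ lt2) // e12 leq_add2r.
  move=> /eqP <- /eqP -> /andP[le1]; rewrite ltnNge => /negP[].
  exact: leqW.
rewrite (partition_big (fun a : ext_node I * ext_node I => (a.1.1, a.2.1))
  (mem (cut_arcs pi))) /=; last first.
  by move=> a /memA[].
apply: ler_sum => -[s t] stA; have : (s, t) \in arcs_of I (edges I).
  by move: stA; rewrite inE => /andP[].
move=> stE; apply: le_trans (capa _ _ _ uvK stE).
rewrite (reindex_onto (fun i : 'I_(max_demand I).+1 =>
    ((s, i), (t, inord (i + arc_len I (s, t)))) : ext_node I * ext_node I)
    (fun a => a.1.2)) /=; last first.
  move=> [[s' i] [t' j]] /= /andP[/memA /= [_ ij] /eqP[? ?]]; subst s' t'.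
  by rewrite -ij inord_val.
(* Constraint (a) sums over all layers; the copies that do not leave [S] carry nonnegative flow. *)
rewrite [leRHS](bigID (fun i : 'I_(max_demand I).+1 =>
   let a := ((s, i), (t, inord (i + arc_len I (s, t)))) : ext_node I * ext_node I in
   [&& a \in X, a.1 \in S & a.2 \notin S])) /=.
rewrite -[leLHS]addr0; apply: lerD; last first.
  apply: sumr_ge0 => i /andP[im _].
  by case/andP: (fpos _ _ uvK (lift_arc_ext stE im)).
rewrite le_eqVlt; apply/orP; left; apply/eqP/eq_bigl => i.
rewrite !eqxx !andbT; apply/idP/andP => [aI|[]//]; split => //.
have [_ /= <-] := memA _ aI.
by rewrite -ltnS ltn_ord.
Qed.

End Cuts.

(** * Distance labels and the union bound *)
Section Labels.
Context {V : finType} (I : instance V).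
Implicit Types (H : {set V * V}).

Lemma path_len_rcons u p t :
  path_len I u (rcons p t) = (path_len I u p + arc_len I (last u p, t))%N.
Proof. by rewrite /path_len -cats1 pairmap_cat sumn_cat /= addn0. Qed.

(** Lengths are integers: if no path has length at most [k], all have length at least [k + 1], and
    so has the infimum. *)
Lemma distP (R : realType) H u v k : (dist R I H u v <= k%:R%:E)%E <->
  exists2 p, path_in I H u v p & (path_len I u p <= k)%N.
Proof.
split=> [|[p pH pk]]; last first.
  apply: (@le_trans _ _ ((path_len I u p)%:R)%:E); last by rewrite lee_fin ler_nat.
  by apply: ereal_inf_lbound; exists p.
apply: contraPP => /forall2NP nop; apply/negP; rewrite -ltNge.
apply: (@lt_le_trans _ _ (k.+1%:R)%:E); first by rewrite lte_fin ltr_nat.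
apply: le_ereal_inf_tmp => _ [p pH <-]; rewrite lee_fin ler_nat ltnNge.
by case: (nop p) => // /negP.
Qed.

Definition reachable H u q k : bool :=
  `[< exists2 p, path_in I H u q p & (path_len I u p <= k)%N >].

(* The distance from u to q in (V, H), capped at d + 1. *)
Definition label H u d q := find (reachable H u q) (iota 0 d.+1).

Lemma label_leS H u d q : (label H u d q <= d.+1)%N.
Proof. by rewrite -[X in (_ <= X)%N](size_iota 0 d.+1) find_size. Qed.

Lemma label_le H u d q k : reachable H u q k -> (k <= d)%N -> (label H u d q <= k)%N.
Proof.
move=> Hk kd; rewrite leqNgt; apply/negP => /(before_find 0%N).
by rewrite nth_iota // add0n Hk.
Qed.

Lemma reachable_label H u d q :
  (label H u d q <= d)%N -> reachable H u q (label H u d q).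
Proof.
move=> ld; have := nth_find 0%N (_ : has (reachable H u q) (iota 0 d.+1)).
by rewrite has_find size_iota ltnS nth_iota ?add0n ?ltnS //; apply.
Qed.

Lemma label_source H u d : label H u d u = 0%N.
Proof.
by apply/eqP; rewrite -leqn0 label_le //; apply/asboolP; exists [::]; rewrite // /path_in /= eqxx.
Qed.

Lemma label_sink H u v d : ~~ reachable H u v d -> label H u d v = d.+1.
Proof.
move=> nr; apply/eqP; rewrite eqn_leq label_leS ltnNge /=; apply/negP => ld.
case/negP: nr; apply/asboolP; have /asboolP[p pH pl] := reachable_label ld.
by exists p => //; apply: leq_trans ld.
Qed.

(** A shortest path to [s] is extended by the arc; beyond [d] the cap gives the inequality. *)
Lemma label_arc H u d s t : (s, t) \in arcs_of I H ->
  (label H u d t <= label H u d s + arc_len I (s, t))%N.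
Proof.
move=> st; case: (leqP (label H u d s + arc_len I (s, t)) d) => ld; last first.
  exact: leq_trans (label_leS _ _ _ _) ld.
apply: label_le => //.
have /asboolP[p /andP[pp /eqP lp] pl] := reachable_label (leq_trans (leq_addr _ _) ld).
apply/asboolP; exists (rcons p t).
  by rewrite /path_in rcons_path pp lp st last_rcons eqxx.
by rewrite path_len_rcons lp leq_add2r.
Qed.

Lemma disjoint_label H u d : H \subset edges I ->
  [disjoint H & cut_edges I (label H u d)].
Proof.
move=> HE; rewrite disjoint_sym disjoint_subset; apply/fintype.subsetP => _ /imsetP[[s t] + ->].
rewrite !inE /= => /andP[stE lt]; apply/negP => eH.
by have := @label_arc H u d s t; rewrite mem_arcs_of // stE => /(_ eH); rewrite leqNgt lt.
Qed.

End Labels.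

(** * Union bound over terminal pairs and labellings *)

Section Feasibility.
Context {R : realType} {V : finType} (I : instance V).
Implicit Types (H : {set V * V}).

(** The ends differ because the empty path serves any pair [(u, u)]; hence two distinct labels are
    prescribed. *)
Lemma infeasible_label H : H \subset edges I -> ~ feasible R I H ->
  exists u v, [/\ (u, v) \in terminals I, u != v &
    label I H u (demand I (u, v)) v = (demand I (u, v)).+1].
Proof.
move=> HE nf; apply/not_existsP => nex; apply: nf; split=> // u v uvK.
apply/distP; apply/asboolP; rewrite -/(reachable _ _ _ _ _); apply: contrapT => /negP nr.
apply: (nex u); exists v; split=> //; last exact: label_sink.
by apply: contraNneq nr => ->; apply/asboolP; exists [::]; rewrite // /path_in /= eqxx.
Qed.

(** [gamma] is chosen to make this [1/n] divided by a bound on the number of bad events. From two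
    nodes on, the integer power in [mu] has a natural exponent. *)
Lemma gammaE : (1 < #|V|)%N -> terminals I != finset.set0 ->
  expR (- gamma R I) =
  (#|V|%:R * (#|terminals I| * (max_demand I).+2 ^ (#|V| - 2))%:R)^-1.
Proof.
move=> n1 K0; rewrite expRN /gamma /mu lnK; last first.
  rewrite posrE !mulr_gt0 ?exprz_gt0 // ?ltr0n ?addn2 ?card_gt0 //.
  exact: ltnW.
by rewrite subzn // -exprnP addn2 natrM natrX -mulrA [_ * #|_|%:R]mulrC.
Qed.

Lemma gamma_ge0 : (1 < #|V|)%N -> terminals I != finset.set0 -> 0 <= gamma R I.
Proof.
move=> n1 K0; rewrite -oppr_le0 -ler_expR expR0 gammaE // invf_le1.
  rewrite -natrM ler1n !muln_gt0 expn_gt0 card_gt0 K0 /= andbT.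
  exact: ltnW.
by rewrite -natrM ltr0n !muln_gt0 expn_gt0 card_gt0 K0 /= andbT ltnW.
Qed.

(* Only the labels off u and v are free: the default value 0 is the label of u,
   and [relabel] overrides the one of v.  Hence the exponent n - 2. *)
Definition free_labels (u v : V) :=
  pffun_on (ord0 : 'I_(max_demand I).+2) [predC pred2 u v] predT.

Definition relabel v (k : nat) (g : {ffun V -> 'I_(max_demand I).+2}) q : nat :=
  if q == v then k else g q.

Lemma card_free_labels u v : u != v ->
  #|free_labels u v| = ((max_demand I).+2 ^ (#|V| - 2))%N.
Proof.
move=> uv; rewrite card_pffun_on card_ord; congr (_ ^ _)%N.
by rewrite -(cardC (pred2 u v)) card2 uv addKn.
Qed.

Lemma rounding_prob_feasible x f : @lp_feasible R V I x f ->
  (1 < #|V|)%N -> terminals I != finset.set0 ->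
  1 - #|V|%:R^-1 <= rounding_prob I x (feasible R I).
Proof.
move=> xf n1 K0; have g0 := gamma_ge0 n1 K0.
have [_ _ _ x01] := xf.
have x0 : {in edges I, forall e, 0 <= x e} by move=> e /x01/andP[].
(* One bad event per terminal pair and free labelling: the rounding misses the whole cut [B]. *)
pose T := ((V * V) * {ffun V -> 'I_(max_demand I).+2})%type.
pose P (i : T) := ((i.1 \in terminals I) && (i.1.1 != i.1.2)) && (i.2 \in free_labels i.1.1 i.1.2).
pose B (i : T) := cut_edges I (relabel i.1.2 (demand I i.1).+1 i.2).
have cP : (#|P| <= #|terminals I| * (max_demand I).+2 ^ (#|V| - 2))%N.
  have -> : #|P| = (\sum_(uv | (uv \in terminals I) && (uv.1 != uv.2))
      \sum_(g in free_labels uv.1 uv.2) 1)%N.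
    by rewrite pair_big_dep -sum1_card; apply: eq_bigl.
  rewrite -sum_nat_const big_mkcondr; apply: leq_sum => uv _.
  by case: ifP => // /card_free_labels <-; rewrite sum1_card.
apply: le_trans (@rounding_prob_ge_union _ _ I x T P
  (fun i H => [disjoint H & B i]) _ (expR (- gamma R I)) x0 g0 _ _).
- rewrite lerD2l lerN2 gammaE // invfM mulrCA ler_piMr ?invr_ge0 ?ler0n //.
  by rewrite ler_pdivrMr ?mul1r ?ler_nat // ltr0n muln_gt0 expn_gt0 card_gt0 K0.
(* The distance labels of an infeasible outcome give the index, erased at [v] to fit the support; at
   [u] they are 0 already. *)
- move=> H HE /(infeasible_label HE)[u [v [uvK uv lv]]].
  have dM : (demand I (u, v) < (max_demand I).+1)%N by rewrite ltnS demand_le_max.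
  pose pi := label I H u (demand I (u, v)).
  have piM q : (pi q < (max_demand I).+2)%N.
    by rewrite ltnS; apply: leq_trans (label_leS _ _ _ _ _) dM.
  pose g := [ffun q => if q == v then ord0 else inord (pi q) : 'I_(max_demand I).+2].
  exists ((u, v), g).
    rewrite /P /= uvK uv /=; apply/pffun_onP; split=> //.
    apply/fintype.subsetP => q; rewrite !inE ffunE negb_or.
    case: (eqVneq q v) => [->|qv]; first by rewrite eqxx.
    rewrite andbT; apply: contraNneq => ->; rewrite /pi label_source.
    by apply/eqP/val_inj; rewrite /= inordK.
  suff -> : B ((u, v), g) = cut_edges I pi by apply: disjoint_label.
  congr (cut_edges I _); apply/boolp.funext => q; rewrite /relabel /= ffunE.
  by case: eqP => [->|_]; rewrite ?inordK.
(* Off the support [g] takes its default value, so [u] has label 0, as the cut bound requires. *)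
- move=> [[u v] g] /andP[/= /andP[uvK uv]] /pffun_onP[/fintype.subsetP sg _].
  apply: rounding_prob_disjoint_le => //; first exact: cut_edges_sub.
  apply: (cut_edges_ge1 xf uvK); rewrite /relabel /= ?eqxx //.
  rewrite (negbTE uv); apply/eqP; have := sg u; rewrite !inE eqxx /=.
  by case: eqP => [-> //|_ /(_ isT)].
Qed.

Lemma rounding_expect_le x f : @lp_feasible R V I x f -> 0 <= gamma R I ->
  rounding_expect I x (spanner_weight R I) <= gamma R I * lp_value I x.
Proof.
move=> [_ _ _ x01] g0; rewrite rounding_expect_weight mulr_sumr.
apply: ler_sum => e eE; rewrite mulrCA ler_wpM2l ?ler0q ?weight_ge0 //.
by rewrite /inclusion_prob ge_min lexx orbT.
Qed.

Lemma gamma_le : terminals I != finset.set0 ->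
  gamma R I <= gamma_bound R #|V| (max_demand I).
Proof.
move=> K0; have n0 : (0 < #|V|)%N.
  by have /set0Pn[[u _] _] := K0; apply/card_gt0P; exists u.
have m0 : 0 < mu R I by rewrite exprz_gt0 // ltr0n addn2.
have K2 : (#|terminals I| <= #|V| ^ 2)%N.
  by rewrite expnS expn1 -card_prod max_card.
rewrite /gamma /gamma_bound ler_ln ?posrE; last 2 first.
- by rewrite !mulr_gt0 ?ltr0n ?card_gt0.
- by rewrite mulr_gt0 ?exprn_gt0 ?ltr0n.
rewrite -/(mu R I) mulrAC ler_pM2r // exprS ler_wpM2l ?ler0n //.
by rewrite -natrX ler_nat.
Qed.

End Feasibility.

(** * Flows along lifted paths *)
Section PathFlow.
Context {V : finType} (I : instance V).
Implicit Types (H : {set V * V}).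

(** Closed detours are cut out. A path without repeated nodes crosses each arc at most once, as
    constraint (a) will demand. *)
Lemma path_len_shorten H u p : path (fun s t => (s, t) \in arcs_of I H) u p ->
  exists p', [/\ path (fun s t => (s, t) \in arcs_of I H) u p', last u p' = last u p,
    uniq (u :: p') & (path_len I u p' <= path_len I u p)%N].
Proof.
have [n] := ubnP (size p); elim: n p => // n IH p; rewrite ltnS => pn pH.
case: (boolP (uniq (u :: p))) => up; first by exists p.
(* One cut: from the first node that recurs, jump to a later occurrence of it. *)
have: exists p', [/\ path (fun s t => (s, t) \in arcs_of I H) u p', last u p' = last u p,
    (size p' < size p)%N & (path_len I u p' <= path_len I u p)%N].
  move: up pH; clear; elim: p u => [|a p IH] u //=.
  rewrite negb_and negbK => upn /andP[ua pH].
  case: (boolP (u \in a :: p)) => uap.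
    have [p1 [p2 E]] : exists p1 p2, a :: p = rcons p1 u ++ p2.
      by case/splitPr: uap => p1 p2; exists p1, p2; rewrite cat_rcons.
    exists p2; have : path (fun s t => (s, t) \in arcs_of I H) u (a :: p) by rewrite /= ua.
    rewrite /path_len.
    rewrite -[last a p]/(last u (a :: p)) -[(size p).+1]/(size (a :: p)) E.
    rewrite cat_path last_cat pairmap_cat sumn_cat size_cat size_rcons last_rcons => /andP[_ ->].
    by split=> //; [rewrite addSn ltnS leq_addl | rewrite leq_addl].
  move: upn; rewrite (negbTE uap) /= => upn.
  have [p' [p'H lp' sp' lenp']] := IH a upn pH.
  exists (a :: p'); split=> //=; first by rewrite ua.
  by rewrite /path_len /= leq_add2l.
move=> [p' [p'H lp' sp' lenp']].
have [p'' [? lp'' ? lenp'']] := IH p' (leq_trans sp' pn) p'H.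
by exists p''; split=> //; [rewrite lp''|apply: leq_trans lenp'].
Qed.

Let node := ext_node I.
Let d := max_demand I.

(* Self-arcs at the last node pad the lift of [p] up to layer [k]; [inord] is
   faithful only if [i + path_len I u p <= k <= d]. *)
Fixpoint lift_path (u : V) (i : nat) (p : seq V) (k : nat) : seq (node * node) :=
  if p is t :: p' then
    ((u, inord i), (t, inord (i + arc_len I (u, t)))) ::
      lift_path t (i + arc_len I (u, t)) p' k
  else [seq ((u, inord j), (u, inord j.+1)) | j <- iota i (k - i)].

Definition path_flow u p k (a : node * node) : nat := count_mem a (lift_path u 0 p k).

Lemma lift_path_ext H u i p k : H \subset edges I ->
  path (fun s t => (s, t) \in arcs_of I H) u p ->
  (i + path_len I u p <= k)%N -> (k <= d)%N ->
  {subset lift_path u i p k <= ext_arcs I}.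
Proof.
move=> HE + + kd; elim: p u i => [|t p IH] u i /=.
  move=> _; rewrite /path_len /= addn0 => ik a /mapP[j]; rewrite mem_iota subnKC // => /andP[_ jk] ->.
  rewrite !inE /= eqxx !inordK ?eqxx ?orbT //; rewrite -/d ltnS; last exact: leq_trans kd.
  exact: leq_trans (ltnW jk) kd.
rewrite /path_len /= -/(path_len I t p) addnA => /andP[ut pH] ik a.
have ik' := leq_trans (leq_addr _ _) ik.
rewrite inE => /predU1P[->|]; last exact: IH.
have := mem_arcs_of (u, t) HE; rewrite ut => /esym/andP[utE _].
rewrite !inE /= utE !inordK ?eqxx //; rewrite -/d ltnS (leq_trans _ kd) //.
exact: leq_trans (leq_addr _ _) ik'.
Qed.

Lemma lift_path_layer u i p k a : (i + path_len I u p <= k)%N -> (k <= d)%N ->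
  a \in lift_path u i p k -> (i <= a.1.2)%N.
Proof.
move=> + kd; elim: p u i => [|t p IH] u i /=.
  rewrite /path_len /= addn0 => ik /mapP[j]; rewrite mem_iota subnKC // => /andP[ij jk] -> /=.
  by rewrite inordK // -/d ltnS; apply: leq_trans (ltnW jk) kd.
rewrite /path_len /= -/(path_len I t p) addnA => ik.
have ik' := leq_trans (leq_addr _ _) ik.
have id := leq_trans (leq_addr _ _) (leq_trans ik' kd).
rewrite inE => /predU1P[->|] /=; first by rewrite inordK.
by move=> /(IH _ _ ik); apply: leq_trans; apply: leq_addr.
Qed.

(* Arcs of a lifted path leave strictly increasing layers. *)
Lemma lift_path_uniq H u i p k : H \subset edges I ->
  path (fun s t => (s, t) \in arcs_of I H) u p ->
  (i + path_len I u p <= k)%N -> (k <= d)%N -> uniq (lift_path u i p k).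
Proof.
move=> HE + + kd; elim: p u i => [|t p IH] u i /=.
  rewrite /path_len /= addn0 => _ ik; rewrite map_inj_in_uniq ?iota_uniq //.
  move=> j j'; rewrite !mem_iota subnKC // => /andP[_ jk] /andP[_ jk'] [].
  move=> /(congr1 val) /=; rewrite !inordK // -/d ltnS.
    exact: leq_trans (ltnW jk') kd.
  exact: leq_trans (ltnW jk) kd.
rewrite /path_len /= -/(path_len I t p) addnA => /andP[ut pH] ik.
rewrite IH // andbT; apply/negP => /(lift_path_layer ik kd) /=.
have ik' := leq_trans (leq_addr _ _) ik.
have id := leq_trans (leq_addr _ _) (leq_trans ik' kd).
rewrite inordK // leqNgt -[X in (X < _)%N]addn0 ltn_add2l => /negP[].
apply: len_gt0; apply: arcs_of_edge_of.
by have := mem_arcs_of (u, t) HE; rewrite ut => /esym/andP[].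
Qed.

(** The counts telescope, as each arc starts where the previous one ends. The additive form avoids
    truncated subtraction. *)
Lemma lift_path_conserve u i p k (q : node) : (i + path_len I u p <= k)%N -> (k <= d)%N ->
  (count (fun a => a.1 == q) (lift_path u i p k) + (q == (last u p, inord k)) =
   count (fun a => a.2 == q) (lift_path u i p k) + (q == (u, inord i)))%N.
Proof.
move=> + kd; elim: p u i => [|t p IH] u i /=.
  rewrite /path_len /= addn0 => ik; rewrite -(subnKC ik).
  (* Only the padding is left: induction on its number of self-arcs. *)
  rewrite addKn; move: (k - i)%N => m; elim: m i {ik} => [|m IHm] i //=; first by rewrite addn0.
  rewrite -addSnnS -addnA IHm; rewrite [(_ , _) == q]eq_sym [(_ , inord i.+1) == q]eq_sym.
  by rewrite addnC (addnC (count _ _)).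
rewrite /path_len /= -/(path_len I t p) addnA => ik.
rewrite -addnA IH // [(u, _) == q]eq_sym [(t, _) == q]eq_sym.
by rewrite addnC (addnC (count _ _)).
Qed.

(** A path without repeated nodes leaves [s] at most once, and [s != t] rules out the padding. The
    factor [s \in u :: p] carries the induction: once [u = s], the rest contributes nothing. *)
Lemma lift_path_proj H u i p k s t : s != t -> uniq (u :: p) ->
  path (fun s t => (s, t) \in arcs_of I H) u p ->
  (count (fun a => (a.1.1 == s) && (a.2.1 == t)) (lift_path u i p k)
    <= (s \in u :: p) && ((s, t) \in arcs_of I H))%N.
Proof.
move=> st; elim: p u i => [|r p IH] u i.
  rewrite /= count_map /= (eq_count (a2 := pred0)) ?count_pred0 // => j /=.
  by apply/negP => /andP[/eqP us /eqP ut]; rewrite -us -ut eqxx in st.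
rewrite [path _ _ _]/= [lift_path _ _ _ _]/= [count _ _]/= cons_uniq.
move=> /andP[ur rp] /andP[ua pH]; have {}IH := IH r (i + arc_len I (u, r))%N rp pH.
rewrite inE; case: (eqVneq u s) => [us|us] /=; last exact: IH.
move: IH; rewrite -us (negbTE ur) leqn0 => /eqP ->.
by rewrite addn0 /= ; case: eqP => // <-; rewrite ua.
Qed.

End PathFlow.

Lemma sum_count_mem (T : finType) (P : pred T) (s : seq T) :
  (\sum_(a | P a) count_mem a s = count P s)%N.
Proof.
elim: s => [|b s IH] /=; first by rewrite big1.
rewrite big_split /= IH; congr (_ + _)%N; case: (boolP (P b)) => Pb.
  by rewrite (bigD1 b) //= eqxx big1 ?addn0 // => a /andP[_]; rewrite eq_sym => /negbTE ->.
by rewrite big1 // => a Pa; case: eqP => // ba; rewrite ba Pa in Pb.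
Qed.

(** * The LP as a relaxation of the spanner problem *)

Section LPSolution.
Context {R : realType} {V : finType} (I : instance V).
Implicit Types (H : {set V * V}).

(** Take for [x] the indicator of [H], and route each terminal pair along the lift of a short simple
    path in [H]. *)
Lemma feasible_lp H : feasible R I H ->
  exists x f, @lp_feasible R V I x f /\ lp_value I x = spanner_weight R I H.
Proof.
move=> [HE Hd].
have ex_path (uv : V * V) : exists p, uv \in terminals I ->
    [/\ path (fun s t => (s, t) \in arcs_of I H) uv.1 p, last uv.1 p = uv.2,
     uniq (uv.1 :: p) & (0 + path_len I uv.1 p <= demand I uv)%N].
  case: uv => u v; have [uvK|] := boolP ((u, v) \in terminals I); last by exists [::].
  have /distP[p /andP[pH /eqP lp] pd] := Hd _ _ uvK.
  have [p' [p'H lp' up' pp']] := path_len_shorten pH.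
  by exists p' => _; split=> //; [rewrite lp'|apply: leq_trans pd].
have [p pP] := choice ex_path.
pose f uv (a : ext_node I * ext_node I) : R := (path_flow uv.1 (p uv) (demand I uv) a)%:R.
have inj_ext uv : uv \in terminals I ->
    {subset lift_path I uv.1 0 (p uv) (demand I uv) <= ext_arcs I}.
  move=> uvK; have [pH _ _ pd] := pP uv uvK.
  exact: lift_path_ext HE pH pd (demand_le_max uvK).
exists (fun e => (e \in H)%:R), f; split; last first.
  rewrite /lp_value /spanner_weight [RHS](big_setID (edges I)) /= (finset.setIidPl HE).
  rewrite (eqP (_ : H :\: edges I == finset.set0)%SET) ?finset.setD_eq0 // big_set0 addr0.
  rewrite [RHS]big_mkcond [LHS]big_mkcond; apply: eq_bigr => e _.
  case: (boolP (e \in H)) => [eH|_]; first by rewrite mulr1 (fintype.subsetP HE).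
  by rewrite mulr0 if_same.
split.
- move=> uv s t uvK st; have [pH lp up pd] := pP uv uvK.
  rewrite /f -natr_sum ler_nat.
  have snt : s != t.
    apply: contraTneq (arcs_of_edge_of st) => ->.
    by rewrite /edge_of; case: ifP => _; apply: edges_loopless.
  pose c (i : 'I_(max_demand I).+1) : ext_node I * ext_node I :=
    ((s, i), (t, inord (i + arc_len I (s, t)))).
  have cI : injective c by move=> i j [].
  pose S := [set i : 'I_(max_demand I).+1 | (i + arc_len I (s, t) <= max_demand I)%N]%SET.
  (* The sum counts arcs of the lift above [(s, t)]: at most one, and none unless the edge is in
     [H]. *)
  apply: (@leq_trans (\sum_(a in c @: S) path_flow uv.1 (p uv) (demand I uv) a)%N).
    rewrite big_imset /=; last by move=> i j _ _ /cI.
    by apply: eq_leq; apply: eq_bigl => i; rewrite inE.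
  rewrite sum_count_mem; apply: leq_trans (sub_count _ _) _; last first.
    apply: leq_trans (lift_path_proj 0 (demand I uv) snt up pH) _.
    by rewrite (mem_arcs_of _ HE) st /=; case: (_ \in _).
  by move=> _ /imsetP[i _ ->]; rewrite /= !eqxx.
- move=> u v q uvK; have [pH lp up pd] := pP (u, v) uvK.
  rewrite /f -!natr_sum !sum_count_mem.
  (* The lift stays inside [ext_arcs I], so restricting counts to it changes nothing. *)
  have cnt (P : pred (ext_node I * ext_node I)) :
      count (fun a => (a \in ext_arcs I) && P a)
        (lift_path I u 0 (p (u, v)) (demand I (u, v))) =
      count P (lift_path I u 0 (p (u, v)) (demand I (u, v))).
    by apply: eq_in_count => a /(inj_ext _ uvK) ->.
  rewrite !cnt.
  have := lift_path_conserve q pd (demand_le_max uvK).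
  rewrite lp /= => /(congr1 (fun n => n%:R : R)); rewrite !natrD.
  have -> : inord 0 = ord0 :> 'I_(max_demand I).+1 by apply/val_inj; rewrite /= inordK.
  move=> E; apply/eqP; rewrite subr_eq [eqbRHS]addrAC eq_sym subr_eq.
  by rewrite E addrC.
- move=> uv a uvK aX; have [pH lp up pd] := pP uv uvK.
  rewrite ler0n lern1 /path_flow count_uniq_mem ?leq_b1 //.
  by apply: (lift_path_uniq HE pH pd); apply: demand_le_max.
- by move=> e _; rewrite ler0n lern1 leq_b1.
Qed.

Lemma lp_optimal_le x f : @lp_optimal R V I x f -> (exists H, feasible R I H) ->
  lp_value I x <= opt R I.
Proof.
move=> [_ xmin] [H0 H0f]; apply: lb_le_inf; first by exists (spanner_weight R I H0), H0.
move=> _ [H /feasible_lp[x' [f' [xf' <-]]] <-]; exact: xmin xf'.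
Qed.

End LPSolution.

(** * Existence of LP optima *)
Lemma continuous_sum (R : realType) (T : topologicalType) (J : Type) (r : seq J)
    (P : pred J) (F : J -> T -> R) :
  (forall i, continuous (F i)) -> continuous (fun v => \sum_(i <- r | P i) F i v).
Proof.
by move=> cF; apply: continuous_big => //; exact: add_continuous.
Qed.

Lemma closed_forall (T : topologicalType) (J : Type) (F : J -> T -> Prop) :
  (forall i, closed [set v | F i v]%classic) -> closed [set v | forall i, F i v]%classic.
Proof.
move=> cF; have -> : [set v | forall i, F i v]%classic = (\bigcap_i [set v | F i v])%classic.
  by apply/seteqP; split => [v Fv i _|v Fv i]; apply: Fv.
by apply: closed_bigI => i _; apply: cF.
Qed.

Lemma closed_imply (T : topologicalType) (P : Prop) (F : T -> Prop) :
  closed [set v | F v]%classic -> closed [set v | P -> F v]%classic.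
Proof.
move=> cF; have [p|np] := pselect P.
  rewrite (_ : [set v | P -> F v]%classic = [set v | F v]%classic) //.
  by apply/seteqP; split=> v; [apply|move=> /= Fv _].
rewrite (_ : [set v | P -> F v]%classic = setT); first exact: closedT.
by apply/seteqP; split=> // v _ /np.
Qed.

Lemma closed_le_fun (R : realType) (T : topologicalType) (F G : T -> R) :
  continuous F -> continuous G -> closed [set v | F v <= G v]%classic.
Proof.
move=> cF cG.
rewrite (_ : [set v | _]%classic = ((fun v => F v - G v) @^-1` [set y | y <= 0])%classic); last first.
  by apply/seteqP; split => v /=; rewrite subr_le0.
apply: preimage_closed; last exact: closed_le.
by move=> v _; apply: cvgB; [exact: cF|exact: cG].
Qed.

Lemma closed_eq_fun (R : realType) (T : topologicalType) (F G : T -> R) :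
  continuous F -> continuous G -> closed [set v | F v = G v]%classic.
Proof.
move=> cF cG.
rewrite (_ : [set v | _]%classic = ([set v | F v <= G v] `&` [set v | G v <= F v])%classic).
  by apply: closedI; apply: closed_le_fun.
by apply/seteqP; split => [v /= ->|v /= [vF vG]]; [|apply/le_anti/andP].
Qed.

Section LPOptimum.
Context {R : realType} {V : finType} (I : instance V).

(** Extreme value theorem: feasible points, encoded as row vectors in the unit cube, form a nonempty
    compact set on which the value is continuous. *)
Lemma lp_optimum_exists : (exists x f, @lp_feasible R V I x f) ->
  exists x f, @lp_optimal R V I x f.
Proof.
move=> [x0 [f0 xf0]].
pose E := ext_node I; pose T := (V * V + (V * V) * (E * E))%type.
pose toX (v : 'rV[R]_#|{: T}|) e := v ord0 (enum_rank (inl e : T)).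
pose toF (v : 'rV[R]_#|{: T}|) uv a := v ord0 (enum_rank (inr (uv, a) : T)).
(* Coordinates that the LP leaves unconstrained are set to 0; this lands in the cube and changes
   neither feasibility nor value. *)
pose restr (x : V * V -> R) (f : V * V -> E * E -> R) : 'rV[R]_#|{: T}| :=
  \row_i match (enum_val i : T) with
         | inl e => if e \in edges I then x e else 0
         | inr (uv, a) => if (uv \in terminals I) && (a \in ext_arcs I) then f uv a else 0
         end.
pose box := [set v : 'rV[R]_#|{: T}| | forall i, `[0, 1]%classic (v ord0 i)]%classic.
pose A := (box `&` [set v | lp_feasible (toX v) (toF v)])%classic.
have cX e : continuous (toX^~ e) by apply: coord_continuous.
have cF uv a : continuous (fun v => toF v uv a) by apply: coord_continuous.
have restrX x f e : e \in edges I -> toX (restr x f) e = x e.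
  by move=> eE; rewrite /toX /restr mxE enum_rankK eE.
have restrF x f uv a : uv \in terminals I -> a \in ext_arcs I -> toF (restr x f) uv a = f uv a.
  by move=> uvK aX; rewrite /toF /restr mxE enum_rankK uvK aX.
have restrA x f : lp_feasible x f -> A (restr x f).
  move=> [capa flow f01 x01]; split.
    move=> i; rewrite /= in_itv /= /restr mxE.
    case: (enum_val i) => [e|[uv a]]; case: ifP => [|_]; rewrite ?lexx ?ler01 //.
      exact: x01.
    by case/andP; apply: f01.
  split.
  - move=> uv s t uvK st; rewrite restrX ?arcs_of_edge_of //.
    rewrite (eq_bigr (fun i : 'I_(max_demand I).+1 =>
      f uv ((s, i), (t, inord (i + arc_len I (s, t)))))); first exact: capa.
    by move=> i im; rewrite restrF // lift_arc_ext.
  - move=> u v q uvK; rewrite -flow //; congr (_ - _); apply: eq_bigr => a /andP[aX _];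
      by rewrite restrF.
  - by move=> uv a uvK aX; rewrite restrF // f01.
  - by move=> e eE; rewrite restrX // x01.
have closedA : closed [set v | lp_feasible (toX v) (toF v)]%classic.
  rewrite (_ : [set v | _]%classic = ([set v | forall uv s t, uv \in terminals I -> (s, t) \in arcs_of I (edges I) ->
        \sum_(i < (max_demand I).+1 | (i + arc_len I (s, t) <= max_demand I)%N)
           toF v uv ((s, i), (t, inord (i + arc_len I (s, t))))
        <= toX v (edge_of I (s, t))] `&`
     [set w | forall u v (q : ext_node I), (u, v) \in terminals I ->
        \sum_(a in ext_arcs I | a.1 == q) toF w (u, v) a
        - \sum_(a in ext_arcs I | a.2 == q) toF w (u, v) a
        = (q == (u, ord0))%:R - (q == (v, inord (demand I (u, v))))%:R] `&`
     [set v | forall uv a, uv \in terminals I -> a \in ext_arcs I -> 0 <= toF v uv a <= 1] `&`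
     [set v | forall e, e \in edges I -> 0 <= toX v e <= 1])%classic); last first.
    by apply/seteqP; split=> v; [move=> [*]; do !split|move=> [[[? ?] ?] ?]; split].
  have closed01 (g : 'rV[R]_#|{: T}| -> R) :
      continuous g -> closed [set v | 0 <= g v <= 1]%classic.
    move=> cg; rewrite (_ : [set v | _]%classic =
      ([set v | (0 : R) <= g v] `&` [set v | g v <= 1])%classic).
      apply: closedI.
        by apply: (@closed_le_fun _ _ (cst 0)) => //; exact: cst_continuous.
      by apply: (@closed_le_fun _ _ _ (cst 1)) => //; exact: cst_continuous.
    by apply/seteqP; split=> v /= => [/andP[]|[-> ->]].
  repeat apply: closedI; repeat (apply: closed_forall => ?); repeat apply: closed_imply.
  - by apply: closed_le_fun => //; apply: continuous_sum.
  - apply: closed_eq_fun; last exact: cst_continuous.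
    have csum (P : pred (E * E)) uv :
        continuous (fun w => \sum_(a in ext_arcs I | P a) toF w uv a).
      by apply: continuous_sum.
    by move=> w; apply: continuousB; exact: csum.
  - exact: closed01.
  - exact: closed01.
have cptA : compact A.
  apply: compact_closedI => //.
  by apply: (@rV_compact R _ (fun=> `[0, 1]%classic)) => _; exact: segment_compact.
have A0 : (A !=set0)%classic by exists (restr x0 f0); apply: restrA.
have cval : continuous (fun v => lp_value I (toX v)).
  apply: continuous_sum => e v; exact: (@continuousM _ _ (cst _) (toX^~ e) v (@cst_continuous _ _ _ _) (cX e v)).
have [v vA vmin] := EVT_min_rV A0 cptA (continuous_subspaceT cval).
exists (toX v), (toF v); split; first by move: vA; rewrite inE => -[].
move=> x f xf; have -> : lp_value I x = lp_value I (toX (restr x f)).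
  by apply: eq_bigr => e eE; rewrite restrX.
by apply: vmin; rewrite inE; apply: restrA.
Qed.
End LPOptimum.

(** * Growth of the ratio *)
Section Asymptotics.
Context {R : realType}.
Implicit Types (p : {poly R}) (D : set (nat * nat)).

(** Only [n] is sent to infinity, so one threshold [N] serves all [d]. *)
Lemma near_large_n D (P : nat * nat -> Prop) N :
  (forall n d, (N <= n)%N -> D (n, d) -> P (n, d)) ->
  \forall nd \near large_n D, P nd.
Proof.
move=> DP; exists ([set n | (N <= n)%N], setT)%classic.
  by split; [exists N | move=> d _].
by move=> [n d] /= [nN _]; apply: DP.
Qed.

Lemma eqO_large_n D (f g : nat * nat -> R^o) (k : R) N :
  (forall n d, (N <= n)%N -> D (n, d) -> `|f (n, d)| <= k * `|g (n, d)|) ->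
  let F := large_n D in f =O_F g.
Proof.
move=> fg F; apply/eqOP.
apply: filterS (nbhs_pinfty_ge (num_real k)) => k' kk'.
apply: (@near_large_n _ _ N) => n d nN Dnd.
by apply: (le_trans (fg n d nN Dnd)); apply: ler_wpM2r.
Qed.

Lemma ln_nat_ge0 (n : nat) : (0 < n)%N -> 0 <= ln (n%:R : R).
Proof. by move=> n0; rewrite ln_ge0 // ler1n. Qed.

Lemma ler_ln_nat (m n : nat) : (0 < m)%N -> (m <= n)%N -> ln (m%:R : R) <= ln n%:R.
Proof.
by move=> m0 mn; rewrite ler_ln ?posrE ?ltr0n ?ler_nat //; apply: leq_trans mn.
Qed.

Lemma ln_nat_le (n : nat) : (0 < n)%N -> ln (n%:R : R) <= n%:R.
Proof.
by move=> n0; rewrite ltW // ln_sublinear // ltr0n.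
Qed.

Lemma gamma_boundE (n d : nat) : (2 <= n)%N ->
  gamma_bound R n d = ln (n%:R : R) *+ 3 + ln ((d + 2)%:R : R) *+ (n - 2).
Proof.
move=> n2; rewrite /gamma_bound subzn // -exprnP.
have n0 : 0 < n%:R :> R by rewrite ltr0n (leq_trans _ n2).
have d0 : 0 < (d + 2)%:R :> R by rewrite ltr0n addn2.
by rewrite lnM ?posrE ?exprn_gt0 // !lnXn.
Qed.

(** [y] stays abstract: it becomes [2 ln d] for [d >= 2], and a multiple of [ln n] for polynomially
    bounded [d]. *)
Lemma gamma_bound_le (n d : nat) (y : R) : (2 <= n)%N -> 
  ln (d + 2)%:R <= y -> `|gamma_bound R n d| <= ln (n%:R : R) *+ 3 + n%:R * y.
Proof.
move=> n2 dy; have n0 : (0 < n)%N by apply: leq_trans n2.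
have y0 : 0 <= ln ((d + 2)%:R : R) by apply: ln_nat_ge0; rewrite addn2.
rewrite gamma_boundE // ger0_norm; last first.
  by rewrite addr_ge0 // mulrn_wge0 // ln_nat_ge0.
rewrite lerD2l -[_ *+ (n - 2)]mulr_natl; apply: ler_pM => //.
by rewrite ler_nat leq_subr.
Qed.

(** With [C] the sum of the absolute coefficients and [s] the size of [p],
    [p(n) <= C n^s <= n^(s+1)] for [n >= C]. One [k] is both exponent and threshold. *)
Lemma horner_nat_le p : exists k : nat, forall n : nat, (k <= n)%N ->
  p.[n%:R] <= n%:R ^+ k.
Proof.
pose C := \sum_(i < size p) `|p`_i|.
have [m Cm] : exists m : nat, C <= m%:R.
  by exists (Num.bound C); apply/ltW/archi_boundP/sumr_ge0.
exists (maxn 1 (maxn m (size p).+1)) => n; rewrite !geq_max => /and3P[n1 mn pn].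
have n1R : 1 <= n%:R :> R by rewrite ler1n.
apply: (@le_trans _ _ (n%:R ^+ (size p).+1)); last first.
  by rewrite ler_weXn2l // !leq_max leqnn !orbT.
apply: (@le_trans _ _ (C * n%:R ^+ size p)); last first.
  rewrite exprS ler_wpM2r ?exprn_ge0 //.
  by rewrite (le_trans Cm) // ler_nat.
rewrite horner_coef /C mulr_suml; apply: ler_sum => i _.
apply: (le_trans (ler_norm _)); rewrite normrM ler_wpM2l // normrX ger0_norm ?ler0n //.
by rewrite ler_weXn2l // ltnW.
Qed.

Lemma ln_poly_bounded p : exists k : nat, forall n d : nat, (k <= n)%N -> (0 < d)%N ->
  d%:R <= p.[n%:R] -> ln (d%:R : R) <= k%:R * ln n%:R.
Proof.
have [k pk] := horner_nat_le p; exists k.+1 => n d kn d0 dp.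
have n0 : (0 < n)%N by apply: leq_trans kn.
rewrite mulr_natl -lnXn ?ltr0n // ler_ln ?posrE ?exprn_gt0 ?ltr0n //.
apply: (le_trans dp); apply: le_trans (pk n (ltnW kn)) _.
by rewrite ler_weXn2l // ler1n.
Qed.

Lemma gamma_bound_O : let F2 := large_n [set nd | (2 <= nd.2)%N]%classic in
  (fun nd => gamma_bound R nd.1 nd.2 : R^o) =O_F2 (fun nd => nd.1%:R * ln nd.2%:R : R^o).
Proof.
have l2 : 0 < ln (2%:R : R) by rewrite ln_gt0 // ltr1n.
(* From [d >= 2] come [ln (d + 2) <= 2 ln d] and [3 ln n <= 3 n <= (3 / ln 2) n ln d]. *)
apply: (@eqO_large_n _ _ _ (3 / ln 2 + 2) 2) => n d /= n2 d2.
have n0 : (0 < n)%N by apply: leq_trans n2.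
have d0 : (0 < d)%N by apply: leq_trans d2.
have l2d : ln (2%:R : R) <= ln d%:R by apply: ler_ln_nat.
have dy : ln ((d + 2)%:R : R) <= ln d%:R *+ 2.
  rewrite -lnXn ?ltr0n // -natrX; apply: ler_ln_nat; first by rewrite addn2.
  by rewrite expnS expn1 (@leq_trans (2 * d)) ?leq_mul2r ?d2 ?orbT // mul2n -addnn leq_add2l.
apply: (le_trans (gamma_bound_le n2 dy)).
rewrite [X in _ <= _ * X]ger0_norm ?mulr_ge0 ?ler0n ?ln_nat_ge0 //.
rewrite mulrDl; apply: lerD; last by rewrite mulrnAr -[leLHS]mulr_natl.
rewrite -[leLHS]mulr_natl -[leRHS]mulrA ler_wpM2l ?ler0n // (le_trans (ln_nat_le n0)) //.
by rewrite mulrCA ler_peMr ?ler0n // mulrC ler_pdivlMr // mul1r.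
Qed.

Lemma eqO_n_log_n p (h : nat * nat -> R^o) :
  let Fp2 := large_n ([set nd | (2 <= nd.2)%N] `&` [set nd | nd.2%:R <= p.[nd.1%:R]])%classic in
  h =O_Fp2 (fun nd => nd.1%:R * ln nd.2%:R : R^o) ->
  h =O_Fp2 (fun nd => nd.1%:R * ln nd.1%:R : R^o).
Proof.
move=> Fp2 hO; apply: (eqO_trans hO).
have [k pk] := ln_poly_bounded p.
apply: (@eqO_large_n _ _ _ k%:R (maxn 1 k)) => n d; rewrite geq_max /= => /andP[n1 kn] [d2 dp].
have d0 : (0 < d)%N by apply: leq_trans d2.
rewrite !ger0_norm ?mulr_ge0 ?ler0n ?ln_nat_ge0 //.
by rewrite mulrCA ler_wpM2l ?ler0n // pk.
Qed.

(** Chaining the two previous bounds would lose [d = 1], where [n ln d] vanishes; hence a direct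
    estimate. *)
Lemma gamma_bound_O_n_log_n p :
  let Fp1 := large_n ([set nd | (1 <= nd.2)%N] `&` [set nd | nd.2%:R <= p.[nd.1%:R]])%classic in
  (fun nd => gamma_bound R nd.1 nd.2 : R^o) =O_Fp1 (fun nd => nd.1%:R * ln nd.1%:R : R^o).
Proof.
have [k pk] := ln_poly_bounded p.
(* For [n >= 3], [d + 2 <= 3 d] gives [ln (d + 2) <= (1 + k) ln n]; the other 3 comes from
   [3 ln n <= 3 n ln n]. *)
apply: (@eqO_large_n _ _ _ (3 + (1 + k%:R)) (maxn 3 k)) => n d; rewrite geq_max /= => /andP[n3 kn] [d0 dp].
have n0 : (0 < n)%N by apply: leq_trans n3.
have dy : ln ((d + 2)%:R : R) <= (1 + k%:R) * ln n%:R.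
  apply: (@le_trans _ _ (ln ((3 * d)%:R : R))).
    apply: ler_ln_nat; first by rewrite addn2.
    by rewrite mulSn leq_add2l mulnC leq_pmull.
  rewrite natrM lnM ?posrE ?ltr0n // mulrDl mul1r lerD //; first exact: ler_ln_nat.
  exact: pk.
apply: (le_trans (gamma_bound_le (ltnW n3) dy)).
rewrite ger0_norm ?mulr_ge0 ?ler0n ?ln_nat_ge0 // [leRHS]mulrDl; apply: lerD.
  by rewrite -[leLHS]mulr_natl ler_wpM2l ?ler0n // ler_peMl ?ln_nat_ge0 // ler1n.
by rewrite mulrCA.
Qed.

End Asymptotics.

(** * The one-node graph and the conclusion *)

Lemma edges_card1 (V : finType) (I : instance V) : (#|V| <= 1)%N ->
  edges I = finset.set0.
Proof.
move=> /fintype_le1P n1; apply/finset.setP => -[s t]; rewrite finset.inE.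
by rewrite (n1 s t); apply/negbTE/edges_loopless.
Qed.

Lemma rounding_expect_opt (R : realType) (V : finType) (I : instance V) x f :
  terminals I != finset.set0 -> (exists H, feasible R I H) -> @lp_optimal R V I x f ->
  rounding_expect I x (spanner_weight R I) <= gamma R I * opt R I.
Proof.
move=> K0 Hf xopt; have [n1|n1] := leqP #|V| 1; last first.
  have g0 := @gamma_ge0 R _ _ n1 K0.
  apply: (le_trans (rounding_expect_le (proj1 xopt) g0)).
  by rewrite ler_wpM2l // (lp_optimal_le xopt).
have E0 := edges_card1 I n1.
rewrite rounding_expect_weight E0 big_set0 /opt.
rewrite (_ : [set _ | _ in _]%classic = [set 0]%classic) ?inf1 ?mulr0 //.
have w0 H : feasible R I H -> spanner_weight R I H = 0.
  by move=> [+ _]; rewrite E0 finset.subset0 => /eqP ->; rewrite /spanner_weight big_set0.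
apply/seteqP; split=> [_ [H /w0 wH <-] //|_ ->].
by have [H Hf'] := Hf; exists H; rewrite ?w0.
Qed.

Local Open Scope classical_set_scope.
Local Open Scope ring_scope.

Theorem theorem15 (R : realType) (p : {poly R}) :
  (forall (V : finType) (I : instance V),
     terminals I != finset.set0 ->
     (exists H, feasible R I H) ->
     (max_demand I)%:R <= p.[#|V|%:R] ->
     [/\ exists x f, @lp_optimal R V I x f,
         forall x f, @lp_optimal R V I x f ->
           1 - #|V|%:R^-1 <= rounding_prob I x (feasible R I) /\
           rounding_expect I x (spanner_weight R I) <= gamma R I * opt R I
       & gamma R I <= gamma_bound R #|V| (max_demand I)]) /\
  (let bound : nat * nat -> R^o := fun nd => gamma_bound R nd.1 nd.2 in
   let n_log_d : nat * nat -> R^o := fun nd => nd.1%:R * ln nd.2%:R in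
   let n_log_n : nat * nat -> R^o := fun nd => nd.1%:R * ln nd.1%:R in
   let poly_bounded := [set nd : nat * nat | nd.2%:R <= p.[nd.1%:R]] in
   let F2 := large_n [set nd | (2 <= nd.2)%N] in
   let Fp2 := large_n ([set nd | (2 <= nd.2)%N] `&` poly_bounded) in
   let Fp1 := large_n ([set nd | (1 <= nd.2)%N] `&` poly_bounded) in
   [/\ bound =O_F2 n_log_d,
       forall h : nat * nat -> R^o, h =O_Fp2 n_log_d -> h =O_Fp2 n_log_n
     & bound =O_Fp1 n_log_n]).
Proof.
split; last first.
  split; [exact: gamma_bound_O|exact: eqO_n_log_n|exact: gamma_bound_O_n_log_n].
move=> V I K0 Hf _; split; last exact: gamma_le.
  have [H /feasible_lp[x [f [xf _]]]] := Hf.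
  by apply: lp_optimum_exists; exists x, f.
move=> x f xopt; split; last exact: rounding_expect_opt xopt.
have [n1|n1] := leqP #|V| 1; last exact: (rounding_prob_feasible (proj1 xopt)).
have n_eq1 : #|V| = 1%N.
  by apply/eqP; rewrite eqn_leq n1; have /finset.set0Pn[[u _] _] := K0; apply/card_gt0P; exists u.
(* With one node the claimed bound is 0, so a nonnegative law suffices; the empty set, its only
   outcome, has probability 1. *)
rewrite n_eq1 invr1 subrr; apply: sumr_ge0 => H /andP[HE _].
have E0 := edges_card1 I n1; move: HE; rewrite powersetE E0 finset.subset0 => /eqP ->.
by rewrite /rounding_law E0 finset.set0D !big_set0 mulr1.
Qed.
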